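(* Let $X_n\in\mathbb R^{n\times p}$ have i.i.d. entries $\{X_{ij}\}$, where $X_{ij}=Z_{ij}U_{ij}$ for all $(i,j)$. The variables $U_{ij}$ (supported on $(0,1)$) are i.i.d. with distribution function $$F(u)=\frac1{\log(e/u)},\qquad u\in(0,1).$$ The variables $Z_{ij}$ are i.i.d. Rademacher random variables independent of $U_{ij}$; that is, $P(Z_{ij}=1)=P(Z_{ij}=-1)=\frac12$. Then $X_{ij}$ is mean-zero sub-Gaussian (hence $X_n$ has i.i.d. mean-zero sub-Gaussian entries). Then, for every $n\ge1$ and $p\ge2$, $$\mathbb E\left[\frac{\sqrt n}{s_{\min}(X_n)}\right]=\infty,\qquad \mathbb E[\kappa(X_n)]=\infty.$$
   Context: A mean-zero random variable $X$ is sub-Gaussian if there is a constant $k_1>0$ with $\mathbb P(|X|>t)\le2\exp(-t^2/k_1^2)$ for all $t\ge0$. For $A\in\mathbb R^{n\times p}$, $s_{\max}(A)$ is the largest singular value, $s_{\min}(A)$ is the $\min(n,p)$-th singular value when the singular values are arranged in descending order, and $\kappa(A)=s_{\max}(A)/s_{\min}(A)$ is the condition number.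
   Formalization: The claim E[κ(X_n)] = ∞ is stated only for n ≥ 2: for n = 1 the matrix has one row, so s_min = s_max and κ = 1 almost surely, hence E[κ] = 1 and the claim fails there. *)

(* Defs.v *)
From HB Require Import structures.
From mathcomp Require Export all_boot all_order all_algebra.
From mathcomp Require Export all_classical all_reals all_analysis.
From mathcomp Require Import polyrcf.

Set Implicit Arguments.
Unset Strict Implicit.
Unset Printing Implicit Defensive.

Import Order.TTheory GRing.Theory Num.Theory.
Import numFieldNormedType.Exports.

Local Open Scope classical_set_scope.
Local Open Scope ring_scope.

Section Probability.
Context (d : measure_display) (T : measurableType d) (R : realType).
Variable P : probability T R.

Definition identically_distributed (I : Type) (X : I -> {RV P >-> R}) : Prop :=
  forall (i j : I) (A : set R), measurable A ->
    P (X i @^-1` A) = P (X j @^-1` A).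

Definition mutually_independent (I : finType) (X : I -> {RV P >-> R}) : Prop :=
  forall (J : {set I}) (A : I -> set R),
    (forall i, i \in J -> measurable (A i)) ->
    P (\bigcap_(i in [set` J]) X i @^-1` A i)
      = (\prod_(i in J) P (X i @^-1` A i))%E.

Definition iid (I : finType) (X : I -> {RV P >-> R}) : Prop :=
  mutually_independent X /\ identically_distributed X.

Definition sigma_of (I : Type) (X : I -> {RV P >-> R}) : set (set T) :=
  <<s [set B | exists i, exists2 A, measurable A & B = X i @^-1` A] >>.

Definition independent_families (I J : Type)
    (X : I -> {RV P >-> R}) (Y : J -> {RV P >-> R}) : Prop :=
  forall A B, sigma_of X A -> sigma_of Y B -> P (A `&` B) = (P A * P B)%E.

(* A zero expectation forces integrability: a difference +oo - +oo is -oo in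
   [\bar R]. *)
Definition mean_zero_subgaussian (X : {RV P >-> R}) : Prop :=
  ('E_P[X] = 0)%E /\
  exists2 k1 : R, 0 < k1 &
    forall t : R, 0 <= t ->
      (P [set w | (t < `|X w|)%R] <= (2 * expR (- t ^+ 2 / k1 ^+ 2))%:E)%E.

Definition rademacher (Z : {RV P >-> R}) : Prop :=
  P (Z @^-1` [set 1]) = (2^-1)%:E /\ P (Z @^-1` [set -1]) = (2^-1)%:E.

Definition inv_log_law (U : {RV P >-> R}) : Prop :=
  P (U @^-1` `]0, 1[) = 1%E /\
  forall u : R, 0 < u < 1 -> cdf U u = ((ln (expR 1 / u))^-1)%:E.

End Probability.

Section SingularValues.
Variable R : realType.

(* Real eigenvalues repeated according to algebraic multiplicity; for a
   symmetric matrix these are all the eigenvalues. *)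
Definition real_eigenvalues (m : nat) (B : 'M[R]_m) : seq R :=
  flatten [seq nseq (mup a (char_poly B)) a | a <- rootsR (char_poly B)].

(* All p square roots of the eigenvalues of A^T A, in descending order.  When
   n < p, the last p - n of them are zero; [smin] stops at the
   [minn n p]-th. *)
Definition singular_values (n p : nat) (A : 'M[R]_(n, p)) : seq R :=
  sort (fun x y => y <= x) [seq Num.sqrt a | a <- real_eigenvalues (A^T *m A)].

Definition smax (n p : nat) (A : 'M[R]_(n, p)) : R :=
  nth 0 (singular_values A) 0.

Definition smin (n p : nat) (A : 'M[R]_(n, p)) : R :=
  nth 0 (singular_values A) (minn n p).-1.

(* Extended-real division, so that x / 0 is +oo for x > 0. *)
Definition cond_number (n p : nat) (A : 'M[R]_(n, p)) : \bar R :=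
  ((smax A)%:E / (smin A)%:E)%E.

End SingularValues.

(* Main.v *)
Require Import Defs.
From mathcomp Require Import spectral complex polyrcf mxpoly.
From mathcomp Require Import measurable_realfun.
From mathcomp Require Import ring lra.

Set Implicit Arguments.
Unset Strict Implicit.
Unset Printing Implicit Defensive.

Import Order.TTheory GRing.Theory Num.Theory.
Import numFieldNormedType.Exports.
Import HBNNSimple.

Local Open Scope classical_set_scope.
Local Open Scope ring_scope.

(** The law of [U] puts so much mass near [0] that all, or all but one, of the
    entries of the matrix are at most [u] with a probability that decays only
    like a power of [1 / log (e / u)], whereas [1 / smin] is then at least of
    order [1 / u].  Put [u = expR (1 - t)], so that [P (U <= u) = 1 / t]: the
    product of the two is at least a constant times [expR t / t ^ m], which is
    unbounded in [t], and an integral with unbounded lower bounds is infinite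
    ([integral_infty_of_slow_decay]).

    For [sqrt n / smin], every entry is taken of size at most [u], and [smin]
    is bounded by the Frobenius norm ([smin_le_small_entries]).  For the
    condition number [smax] has to stay away from [0], so one entry is kept
    above [1/2] and the others at most [u].  The matrix is then close to one of
    rank one, and [smin], being at most the second singular value, is of order
    [u] ([smax_ge_smin_le_one_large_entry]).  This last estimate follows from
    two identities for the squared singular values [l] of [A], namely
    [sum l = tr (A^T A)] and [sum l ^ 2 = tr ((A^T A) ^ 2)]
    ([singular_values_traces]), which come from the spectral theorem.

    The laws of the entries [Z U] are obtained by summing over the values of
    all the signs ([probability_sign_expansion]): on the event that [Z i] is
    the sign [f i] for all [i], the condition [Z i * U i \in A i] only concerns
    [U i], so that independence of [Z] and [U] applies directly, and the sum
    over [f] of products is a product of sums. *)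

(** * Spectrum of a real symmetric matrix *)

Lemma char_poly_conj (F : fieldType) (m : nat) (Q D : 'M[F]_m) :
  Q \in unitmx -> char_poly (invmx Q *m D *m Q) = char_poly D.
Proof.
move=> Qu; rewrite /char_poly /char_poly_mx.
have QP : map_mx polyC Q \in unitmx by rewrite map_unitmx.
suff -> : 'X%:M - map_mx polyC (invmx Q *m D *m Q) =
   map_mx polyC (invmx Q) *m ('X%:M - map_mx polyC D) *m map_mx polyC Q.
  rewrite !det_mulmx mulrC mulrA -det_mulmx -map_mxM mulmxV//.
  by rewrite map_mx1 det1 mul1r.
rewrite mulmxBr mulmxBl !map_mxM; congr (_ - _).
by rewrite scalar_mxC -mulmxA -map_mxM mulVmx// map_mx1 mulmx1.
Qed.

(** Over [R[i]] the matrix is Hermitian, hence unitarily diagonalizable with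
    real eigenvalues; the three identities hold for its diagonal form and are
    read back in [R]. *)
Lemma symmetric_spectrum (R : rcfType) (m : nat) (B : 'M[R]_m) : B^T = B ->
  exists L : 'I_m -> R,
    [/\ char_poly B = \prod_i ('X - (L i)%:P),
        \tr B = \sum_i L i & \tr (B *m B) = \sum_i L i ^+ 2].
Proof.
move=> Bsym; pose C := map_mx (real_complex R) B.
have Cherm : C \is hermsymmx.
  apply: realsym_hermsym.
    apply/is_hermitianmxP; rewrite expr0 scale1r map_mx_id//.
    by rewrite /C map_trmx Bsym.
  by apply/mxOverP => i j; rewrite mxE; apply/complex_realP; exists (B i j).
have := hermitian_spectral_diag_real Cherm.
have /hermitian_normalmx/orthomx_spectralP := Cherm.
set Q := spectralmx C; set D := spectral_diag C => CE /mxOverP Dreal.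
have Qu : Q \in unitmx by exact: spectral_unit.
have DE i : D 0 i = real_complex R (complex.Re (D 0 i)) by rewrite RRe_real.
have CCE : C *m C = invmx Q *m (diag_mx D *m diag_mx D) *m Q.
  by rewrite {1 2}CE !mulmxA mulmxK.
have trE (E : 'M[R[i]]_m) : \tr (invmx Q *m E *m Q) = \tr E.
  by rewrite mxtrace_mulC mulmxA mulmxV// mul1mx.
exists (fun i => complex.Re (D 0 i)); split.
- apply: (map_inj_poly (@complexI R)); rewrite ?rmorph0//.
  rewrite map_char_poly -/C CE char_poly_conj//.
  rewrite char_poly_trig ?diag_mx_is_trig// rmorph_prod.
  apply: eq_bigr => i _; rewrite rmorphB/= map_polyX map_polyC/=.
  by rewrite -DE !mxE eqxx mulr1n.
- apply: (@complexI R); rewrite [RHS]rmorph_sum.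
  rewrite -trace_map_mx -/C CE trE.
  by rewrite mxtrace_diag; apply: eq_bigr => i _; rewrite {1}DE.
- apply: (@complexI R); rewrite [RHS]rmorph_sum.
  rewrite -trace_map_mx map_mxM -/C CCE trE.
  rewrite /mxtrace; apply: eq_bigr => i _.
  by rewrite mul_diag_mx !mxE eqxx mulr1n DE -rmorphM -expr2.
Qed.

(** When the characteristic polynomial splits, listing its distinct real roots
    with their multiplicities recovers all its roots. *)
Lemma perm_real_eigenvalues (R : realType) (m : nat) (B : 'M[R]_m) (s : seq R) :
  char_poly B = \prod_(a <- s) ('X - a%:P) -> perm_eq (real_eigenvalues B) s.
Proof.
move=> BE; have B0 : char_poly B != 0 by rewrite monic_neq0 ?char_poly_monic.
apply/allP => x _ /=; apply/eqP.
rewrite -(mu_prod_XsubC x s) -BE count_flatten -map_comp.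
rewrite (eq_map (g := fun a => if a == x then mup x (char_poly B) else 0%N));
  last first.
  move=> a /=; rewrite count_nseq /=.
  by case: eqP => [->|]; rewrite (mul1n, mul0n).
have : uniq (rootsR (char_poly B)) by exact: uniq_roots.
have [xr|xnr] := boolP (x \in rootsR (char_poly B)).
  move=> /(count_uniq_mem x); rewrite xr.
  elim: (rootsR _) => //= a r IH; have [_|_] := eqVneq a x; last first.
    by rewrite add0n => /IH->.
  move=> [c0]; rewrite -[RHS]addn0; congr addn.
  elim: r c0 {IH} => //= b r IH; case: (b == x) => //= ?; exact: IH.
move=> _; rewrite mupNroot; last first.
  by have := roots_on_rootsR B0 x; rewrite in_itv/= => ->.
by rewrite sumnE big_map big1// => a _; case: ifP.
Qed.

(** * Bounds on the extreme singular values *)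

Section SingularValueBounds.
Variables (R : realType) (n p : nat) (A : 'M[R]_(n, p)).

(** If [v] is an eigenvector for [a], then [a * |v|^2 = |v A^T|^2]. *)
Lemma gram_eigenvalue_ge0 (a : R) : root (char_poly (A^T *m A)) a -> 0 <= a.
Proof.
rewrite -eigenvalue_root_char => /eigenvalueP[v vA v0].
have sq_ge0 q (w : 'rV[R]_q) : 0 <= (w *m w^T) 0 0.
  by rewrite mxE sumr_ge0// => i _; rewrite !mxE -expr2 sqr_ge0.
have vv : 0 < (v *m v^T) 0 0.
  rewrite lt_neqAle sq_ge0 andbT eq_sym; apply: contra v0.
  rewrite mxE psumr_eq0 => [/allP v0|i _]; last by rewrite !mxE -expr2 sqr_ge0.
  apply/eqP/rowP => i; have := v0 i (mem_index_enum _).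
  by rewrite !mxE mulf_eq0 orbb => /eqP.
have := sq_ge0 _ (v *m A^T).
by rewrite trmx_mul trmxK mulmxA -(mulmxA v) vA -scalemxAl mxE pmulr_lge0.
Qed.

Lemma singular_values_ge0 (x : R) : x \in singular_values A -> 0 <= x.
Proof. by rewrite mem_sort => /mapP[a _ ->]; exact: sqrtr_ge0. Qed.

Lemma sorted_singular_values :
  sorted (fun x y : R => y <= x) (singular_values A).
Proof. by apply: sort_sorted => x y; exact: le_total. Qed.

(** The eigenvalues of [A^T A] being nonnegative, taking their square roots
    loses nothing: the moments of its spectrum are even moments of the singular
    values. *)
Lemma singular_values_traces :
  \sum_(x <- singular_values A) x ^+ 2 = \tr (A^T *m A) /\
  \sum_(x <- singular_values A) x ^+ 4 = \tr ((A^T *m A) *m (A^T *m A)).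
Proof.
have [|L [LE -> ->]] := @symmetric_spectrum R p (A^T *m A).
  by rewrite trmx_mul trmxK.
have L0 i : 0 <= L i.
  apply: gram_eigenvalue_ge0; rewrite LE /root horner_prod; apply/prodf_eq0.
  by exists i => //; rewrite !hornerE subrr.
have pe : perm_eq (singular_values A)
    [seq Num.sqrt a | a <- map L (index_enum 'I_p)].
  rewrite perm_sort perm_map// perm_real_eigenvalues//.
  by rewrite LE big_map.
by split; rewrite (perm_big _ pe) /= !big_map; apply: eq_bigr => i _;
  rewrite ?(exprM _ 2 2) sqr_sqrtr.
Qed.

Lemma gram_trace : \tr (A^T *m A) = \sum_i \sum_j A i j ^+ 2.
Proof.
rewrite /mxtrace exchange_big; apply: eq_bigr => j _; rewrite mxE.
by apply: eq_bigr => i _; rewrite mxE -expr2.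
Qed.

Lemma entry_le_gram_sqr_trace (i : 'I_n) (j : 'I_p) :
  (A i j ^+ 2) ^+ 2 <= \tr ((A^T *m A) *m (A^T *m A)).
Proof.
set B := A^T *m A.
have Bsym k l : B k l = B l k.
  by rewrite !mxE; apply: eq_bigr => q _; rewrite !mxE mulrC.
have AB : A i j ^+ 2 <= B j j.
  rewrite mxE (bigD1 i)//= mxE -expr2 lerDl sumr_ge0// => q _.
  by rewrite mxE -expr2 sqr_ge0.
apply: (@le_trans _ _ (B j j ^+ 2)).
  by rewrite lerXn2r ?nnegrE ?sqr_ge0// (le_trans _ AB) ?sqr_ge0.
clearbody B; rewrite /mxtrace (bigD1 j)//= mxE (bigD1 j)//=.
rewrite -expr2 -addrA lerDl addr_ge0//.
  by rewrite sumr_ge0// => q _; rewrite (Bsym q j) -expr2 sqr_ge0.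
rewrite sumr_ge0// => k _; rewrite mxE sumr_ge0// => q _.
by rewrite (Bsym q k) -expr2 sqr_ge0.
Qed.

(** The default value 0 of [nth] is below every singular value, so that indices
    beyond the end of the list follow the same order. *)
Lemma nth_singular_values_ge0 k : 0 <= nth 0 (singular_values A) k.
Proof.
have [ks|ks] := ltnP k (size (singular_values A)); last by rewrite nth_default.
by rewrite (singular_values_ge0 (mem_nth _ ks)).
Qed.

Lemma nth_singular_values_anti k l : (k <= l)%N ->
  nth 0 (singular_values A) l <= nth 0 (singular_values A) k.
Proof.
move=> kl; have [ls|ls] := ltnP l (size (singular_values A)); last first.
  by rewrite (nth_default _ ls) nth_singular_values_ge0.
apply: (sorted_leq_nth _ _ _ sorted_singular_values) => //.
- by move=> x y z xy yz; exact: le_trans yz xy.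
- exact: leq_ltn_trans kl ls.
Qed.

Lemma smin_le_frobenius : smin A ^+ 2 <= \sum_i \sum_j A i j ^+ 2.
Proof.
rewrite -gram_trace -singular_values_traces.1.
apply: (@le_trans _ _ (smax A ^+ 2)).
  rewrite lerXn2r ?nnegrE ?nth_singular_values_ge0//.
  exact: nth_singular_values_anti.
rewrite /smax; case: (singular_values A) => [|x s].
  by rewrite big_nil expr0n.
by rewrite big_cons /= lerDl sumr_ge0// => y _; rewrite sqr_ge0.
Qed.

(** With at least two rows and two columns, [smin] is at most the second
    singular value, and the two largest ones contribute to the Frobenius
    norm. *)
Lemma smax_smin_le_frobenius : (2 <= n)%N -> (2 <= p)%N ->
  smax A ^+ 2 + smin A ^+ 2 <= \sum_i \sum_j A i j ^+ 2.
Proof.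
move=> n2 p2; rewrite -gram_trace -singular_values_traces.1.
apply: (@le_trans _ _ (smax A ^+ 2 + nth 0 (singular_values A) 1 ^+ 2)).
  rewrite lerD2l lerXn2r ?nnegrE ?nth_singular_values_ge0//.
  rewrite nth_singular_values_anti// -ltnS prednK leq_min ?n2 ?p2//.
  by rewrite (ltnW n2) (ltnW p2).
rewrite /smax; case: (singular_values A) => [|x [|y s]] /=.
- by rewrite big_nil expr0n addr0.
- by rewrite big_seq1 expr0n addr0.
- by rewrite !big_cons addrA lerDl sumr_ge0// => z _; rewrite sqr_ge0.
Qed.

(** The sum of the fourth powers of the singular values is at most [smax ^ 2]
    times the sum of their squares, and dominates every diagonal entry of
    [(A^T A) ^ 2]. *)
Lemma sqr_entry_le_smax_frobenius i j :
  (A i j ^+ 2) ^+ 2 <= smax A ^+ 2 * \sum_i \sum_j A i j ^+ 2.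
Proof.
apply: le_trans (entry_le_gram_sqr_trace i j) _.
rewrite -gram_trace -singular_values_traces.1 -singular_values_traces.2.
rewrite mulr_sumr big_seq [leRHS]big_seq ler_sum// => x xs.
rewrite (exprM _ 2 2) expr2 ler_wpM2r ?sqr_ge0//.
rewrite lerXn2r ?nnegrE ?nth_singular_values_ge0 ?(singular_values_ge0 xs)//.
have /(nthP 0)[k _ <-] := xs; exact: nth_singular_values_anti.
Qed.

End SingularValueBounds.

(** * Symmetric intervals and almost sure events *)

Lemma measurable_abs_le (R : realType) (u : R) :
  measurable [set x : R | `|x| <= u].
Proof.
rewrite (_ : mkset _ = `[-u, u]%classic)//.
by apply/seteqP; split => x; rewrite /= in_itv/= ler_norml.
Qed.

Lemma measurable_abs_gt (R : realType) (u : R) :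
  measurable [set x : R | u < `|x|].
Proof.
rewrite (_ : mkset _ = ~` [set x : R | `|x| <= u]).
  by apply: measurableC; exact: measurable_abs_le.
by apply/seteqP; split => x /=; rewrite ltNge => /negP.
Qed.

Section Probability0.
Context (d : measure_display) (T : measurableType d) (R : realType).
Variable P : probability T R.

Lemma probability_fin_bigcup (I : finType) (F : I -> set T) :
  (forall i, measurable (F i)) -> trivIset setT F ->
  P (\bigcup_i F i) = (\sum_i P (F i))%E.
Proof.
move=> mF tF; rewrite measure_fin_bigcup//; last exact: finite_finset.
rewrite fsbig_finite; last exact: finite_finset.
apply: perm_big; apply: uniq_perm.
- exact: finmap.fset_uniq.
- exact: index_enum_uniq.
- move=> i; rewrite mem_index_enum in_fset_set ?mem_setT//.
  exact: finite_finset.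
Qed.

Lemma probability_setI_sure (A G : set T) : measurable A -> measurable G ->
  P G = 1%E -> P A = P (A `&` G).
Proof.
move=> mA mG PG.
have PAG : P (A `\` G) = 0%E.
  apply/eqP; rewrite -measure_le0 -[leRHS](subee (x := 1))//.
  rewrite -[X in (_ - X)%E]PG -probability_setC//.
  apply: le_measure; rewrite ?inE; last exact: subIsetr.
    exact: measurableD.
  exact: measurableC.
transitivity (P (A `\` G) + P (A `&` G))%E; first exact: measureDI.
by rewrite PAG add0e.
Qed.

End Probability0.

(** * Products with independent random signs *)

Section SignExpansion.
Context (d : measure_display) (T : measurableType d) (R : realType).
Variable P : probability T R.

Definition flip (b : bool) (A : set R) : set R := [set x | A ((-1) ^+ b * x)].

Lemma measurable_flip b A : measurable A -> measurable (flip b A).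
Proof.
move=> mA; rewrite -[flip b A]setTI.
by apply: (@mulrl_measurable R setT ((-1) ^+ b)).
Qed.

(** The mass that the product of [U] with an independent uniform sign gives to
    [A] (see [probability_flip]).  It is real-valued because distributing a
    product over a sum fails in [\bar R]. *)
Definition flip_prob (U : {RV P >-> R}) (A : set R) : R :=
  \sum_(b : bool) 2^-1 * fine (P (U @^-1` flip b A)).

Variables (I : finType) (X Z U : I -> {RV P >-> R}).
Hypothesis hX : forall i w, X i w = Z i w * U i w.
Hypothesis hU : mutually_independent U.
Hypothesis hZ : mutually_independent Z.
Hypothesis hZ_law : forall i, rademacher (Z i).
Hypothesis hZU : independent_families Z U.

Lemma sigma_of_bigcap (V : I -> {RV P >-> R}) (A : I -> set R) :
  (forall i, measurable (A i)) -> sigma_of V (\bigcap_i V i @^-1` A i).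
Proof.
move=> mA.
pose G := [set B | exists i, exists2 A, measurable A & B = V i @^-1` A].
apply: (@fin_bigcap_measurable _ (g_sigma_algebraType G)) => [|i _].
  exact: finite_finset.
by apply: sub_sigma_algebra; exists i, (A i).
Qed.

Lemma mutually_independentT (V : I -> {RV P >-> R}) (A : I -> set R) :
  mutually_independent V -> (forall i, measurable (A i)) ->
  P (\bigcap_i V i @^-1` A i) = (\prod_i P (V i @^-1` A i))%E.
Proof.
move=> hV mA; have := hV [set: I]%SET A (fun i _ => mA i).
rewrite (_ : [set` _] = setT); last first.
  by apply/seteqP; split => i //=; rewrite inE.
by move=> ->; apply: eq_bigl => i; rewrite inE.
Qed.

(** These events are disjoint and, each having probability [2 ^- #|I|], cover
    almost everything. *)
Let signs (f : {ffun I -> bool}) : set T :=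
  \bigcap_i Z i @^-1` [set (-1) ^+ f i].

Let measurable_bigcap_RV (V : I -> {RV P >-> R}) (A : I -> set R) :
  (forall i, measurable (A i)) -> measurable (\bigcap_i V i @^-1` A i).
Proof.
move=> mA; apply: fin_bigcap_measurable => [|i _]; first exact: finite_finset.
exact: measurable_funPTI.
Qed.

Let measurable_signs f : measurable (signs f).
Proof. by apply: measurable_bigcap_RV => i; exact: measurable_set1. Qed.

Let trivIset_signs : trivIset setT signs.
Proof.
move=> f g _ _ [w [fw gw]]; apply/ffunP => i.
apply: (@signr_inj R).
by rewrite -(fw i Logic.I) -(gw i Logic.I).
Qed.

Let probability_signs f : P (signs f) = ((2^-1) ^+ #|I|)%:E.
Proof.
rewrite mutually_independentT//.
rewrite (eq_bigr (fun=> (2^-1)%:E)); last first.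
  move=> i _; have [Z1 ZN1] := hZ_law i.
  by case: (f i); rewrite ?expr1 ?expr0.
by rewrite prodEFin prodr_const.
Qed.

(** The event is cut along the sign patterns [signs f]; on each piece it is a
    condition on [U] alone, and the resulting sum over [f] factors. *)
Lemma probability_sign_expansionT (A : I -> set R) :
  (forall i, measurable (A i)) ->
  P (\bigcap_i X i @^-1` A i) = (\prod_i flip_prob (U i) (A i))%:E.
Proof.
move=> mA.
have PG : P (\bigcup_f signs f) = 1%E.
  rewrite probability_fin_bigcup//.
  under eq_bigr do rewrite probability_signs.
  rewrite sumEFin sumr_const card_ffun card_bool -[_ *+ _]mulr_natl natrX.
  by rewrite -exprMn divff// expr1n.
rewrite (probability_setI_sure _ _ PG)//; first last.
- by apply: fin_bigcup_measurable => // ; exact: finite_finset.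
- exact: measurable_bigcap_RV.
rewrite setI_bigcupr probability_fin_bigcup; first last.
- by apply: trivIset_setIl; exact: trivIset_signs.
- by move=> f; apply: measurableI => //; exact: measurable_bigcap_RV.
rewrite /flip_prob bigA_distr_bigA -sumEFin; apply: eq_bigr => f _.
have -> : \bigcap_i X i @^-1` A i `&` signs f =
   signs f `&` \bigcap_i U i @^-1` flip (f i) (A i).
  rewrite setIC; apply/seteqP; split => w [sw Aw]; split => // i _ /=.
    by have := Aw i Logic.I; rewrite /= hX (sw i Logic.I).
  by rewrite hX (sw i Logic.I); exact: Aw.
rewrite hZU; last 2 first.
- by apply: sigma_of_bigcap => i; exact: measurable_set1.
- by apply: sigma_of_bigcap => i; exact: measurable_flip.
rewrite probability_signs mutually_independentT//; last first.
  by move=> i; exact: measurable_flip.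
rewrite big_split/= prodr_const EFinM; congr (_ * _)%E.
rewrite -prodEFin; apply: eq_bigr => i _; rewrite fineK// fin_num_measure//.
by apply: measurable_funPTI; exact: measurable_flip.
Qed.

Lemma flip_probT (V : {RV P >-> R}) : flip_prob V setT = 1.
Proof.
rewrite /flip_prob big_bool.
rewrite (_ : flip true setT = setT)// (_ : flip false setT = setT)//.
by rewrite preimage_setT probability_setT /=; lra.
Qed.

(** Indices outside [J] are given the trivial condition [setT], whose factor
    is 1. *)
Lemma probability_sign_expansion (J : {set I}) (A : I -> set R) :
  (forall i, i \in J -> measurable (A i)) ->
  P (\bigcap_(i in [set` J]) X i @^-1` A i) =
  (\prod_(i in J) flip_prob (U i) (A i))%:E.
Proof.
move=> mA; pose A' i := if i \in J then A i else setT.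
have -> : \bigcap_(i in [set` J]) X i @^-1` A i = \bigcap_i X i @^-1` A' i.
  rewrite /A'; apply/seteqP; split=> w Aw i /=.
    by move=> _; case: ifPn => // iJ; exact: Aw.
  by move=> iJ; have := Aw i Logic.I; rewrite /= iJ.
rewrite probability_sign_expansionT; last first.
  by move=> i; rewrite /A'; case: ifPn => // /mA.
congr EFin; rewrite [RHS]big_mkcond; apply: eq_bigr => i _; rewrite /A'.
by case: ifP => // _; rewrite flip_probT.
Qed.

Lemma probability_flip i A : measurable A ->
  P (X i @^-1` A) = (flip_prob (U i) A)%:E.
Proof.
move=> mA.
have := @probability_sign_expansion [set i]%SET (fun=> A) (fun _ _ => mA).
rewrite big_set1 => <-; congr (P _); apply/seteqP; split => w Aw /=.
  by move=> j /=; rewrite inE => /eqP->.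
by apply: Aw; rewrite /= inE.
Qed.

(** The factor of index [i] in the sign expansion is the law of [X i], which
    depends only on the law of [U i]. *)
Lemma sign_product_iid : identically_distributed U -> iid X.
Proof.
move=> idU; split=> [J A mA|i j A mA].
  rewrite probability_sign_expansion// -prodEFin; apply: eq_bigr => i iJ.
  by rewrite probability_flip//; exact: mA.
rewrite !probability_flip//; congr EFin; apply: eq_bigr => b _.
by rewrite (idU i j)//; exact: measurable_flip.
Qed.

End SignExpansion.

(** * A criterion for infinite integrals *)

Section InfiniteIntegral.
Context (d : measure_display) (T : measurableType d) (R : realType).
Variable P : probability T R.

(** The integral of a nonnegative function, measurable or not, is the supremum
    over the simple functions below it.  This lets the integrals involving
    [smin] be bounded without a study of how the singular values vary with the
    matrix. *)
Lemma ge0_integral_le (f g : T -> \bar R) :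
  (forall w, 0 <= f w)%E -> (forall w, f w <= g w)%E ->
  (\int[P]_w f w <= \int[P]_w g w)%E.
Proof.
move=> f0 fg.
rewrite !ge0_integralTE// => [|w]; last exact: le_trans (fg w).
apply: ereal_sup_le => _ [h hf <-]; exists h => //= w.
exact: le_trans (fg w).
Qed.

Lemma integral_ge_on (f : T -> \bar R) (E : set T) (r : R) :
  measurable E -> 0 <= r -> (forall w, 0 <= f w)%E ->
  (forall w, E w -> r%:E <= f w)%E -> (r%:E * P E <= \int[P]_w f w)%E.
Proof.
move=> mE r0 f0 Ef.
rewrite -integral_cst// integral_mkcond; apply: ge0_integral_le => w.
  by rewrite patchE; case: ifPn => // _; rewrite lee_fin.
by rewrite patchE; case: ifPn => //; rewrite inE => /Ef.
Qed.

(** For each [t] the integral is at least [c * k * expR t / t ^ m], and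
    [expR t >= t ^ m.+1 / m.+1`!]. *)
Lemma integral_infty_of_slow_decay (f : T -> \bar R) (E : R -> set T)
    (c k : R) (m : nat) :
  (forall w, 0 <= f w)%E -> 0 < c -> 0 < k ->
  (forall t, 1 < t -> measurable (E t)) ->
  (forall t, 1 < t -> ((c / t ^+ m)%:E <= P (E t))%E) ->
  (forall t w, 1 < t -> E t w -> ((k * expR t)%:E <= f w)%E) ->
  (\int[P]_w f w = +oo)%E.
Proof.
move=> f0 c0 k0 mE PE fE; apply/eqyP => M M0.
have F0 : 0 < (m.+1)`!%:R :> R by rewrite ltr0n fact_gt0.
(* Chosen so that [c * k * (t / m.+1`!)] exceeds [M]. *)
pose t : R := 1 + M * (m.+1)`!%:R / (c * k).
have t1 : 1 < t by rewrite ltrDl divr_gt0 ?mulr_gt0.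
have t0 : 0 < t by exact: lt_trans t1.
have kt : 0 <= k * expR t by rewrite mulr_ge0 ?expR_ge0 ?ltW.
apply: le_trans (integral_ge_on (mE t t1) kt f0 (fE t ^~ t1)).
apply: (@le_trans _ _ ((k * expR t)%:E * (c / t ^+ m)%:E)%E); last first.
  by rewrite lee_pmul2l// ?lte_fin ?mulr_gt0 ?expR_gt0// PE.
have ck0 : 0 < c * k by rewrite mulr_gt0.
have tm : 0 < t ^+ m by rewrite exprn_gt0.
have et : t / (m.+1)`!%:R <= expR t / t ^+ m.
  rewrite ler_pdivlMr// mulrAC -exprS.
  by apply: le_trans (expR_ge1Dxn m (ltW t0)); rewrite lerDr.
rewrite lee_fin mulrACA (mulrC k).
apply: le_trans (ler_wpM2l (ltW ck0) et).
rewrite mulrA ler_pdivlMr// mulrC /t mulrDr mulr1.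
rewrite [X in _ + X]mulrC divfK ?gt_eqF//.
by rewrite mulrC lerDr ltW.
Qed.

End InfiniteIntegral.

(** * The inverse-logarithmic law and symmetric laws *)

Section Laws.
Context (d : measure_display) (T : measurableType d) (R : realType).
Variable P : probability T R.
Implicit Types U X : {RV P >-> R}.

Lemma flip_prob_flip U A : flip_prob U (flip true A) = flip_prob U A.
Proof.
rewrite /flip_prob !big_bool /= addrC.
congr (2^-1 * fine (P _) + 2^-1 * fine (P _));
  congr (U @^-1` _); apply/seteqP; split => x;
  by rewrite /flip/= !(expr1, expr0, mulN1r, mul1r, opprK).
Qed.

Lemma flip_prob_sym U A : (forall x, A (- x) <-> A x) ->
  flip_prob U A = fine (P (U @^-1` A)).
Proof.
move=> Asym; rewrite /flip_prob big_bool /=.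
have -> : flip true A = A.
  by apply/seteqP; split => x; rewrite /flip/= expr1 mulN1r Asym.
have -> : flip false A = A.
  by apply/seteqP; split => x; rewrite /flip/= expr0 mul1r.
by lra.
Qed.

Lemma inv_log_law_le U u : inv_log_law U -> 0 < u < 1 ->
  P (U @^-1` [set x | `|x| <= u]) = ((1 - ln u)^-1)%:E.
Proof.
move=> [U01 Ucdf] /[dup] u01 /andP[u0 u1].
have <- : ln (expR 1 / u) = 1 - ln u.
  by rewrite ln_div ?posrE ?expR_gt0// expRK.
rewrite -Ucdf// /cdf /distribution /pushforward.
have mG : measurable (U @^-1` `]0, 1[) by apply: measurable_funPTI.
rewrite (probability_setI_sure _ mG U01); last first.
  by apply: measurable_funPTI; exact: measurable_abs_le.
rewrite [RHS](probability_setI_sure _ mG U01); last exact: measurable_funPTI.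
congr (P _); apply/seteqP.
split => w /= []; rewrite !in_itv/= => Uu /andP[U0 U1].
  by rewrite U0 U1; split => //; apply: le_trans Uu; exact: ler_norm.
by rewrite U0 U1 gtr0_norm.
Qed.

Lemma inv_log_law_gt_half U : inv_log_law U ->
  P (U @^-1` [set x | 2^-1 < `|x|]) = (1 - (1 + ln 2)^-1)%:E.
Proof.
move=> hU.
have -> : U @^-1` [set x | 2^-1 < `|x|] = ~` (U @^-1` [set x | `|x| <= 2^-1]).
  by apply/seteqP; split => w /=; rewrite ltNge => /negP.
rewrite probability_setC; last first.
  by apply: measurable_funPTI; exact: measurable_abs_le.
rewrite inv_log_law_le//; last by lra.
by rewrite lnV ?posrE// opprK.
Qed.

(** The positive and negative parts have the same integral, since [X] and [- X]
    have the same law; this integral is finite because [X] is almost surely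
    bounded, hence the difference is 0. *)
Lemma symmetric_mean0 X : (forall A, measurable A ->
    P (X @^-1` A) = P (X @^-1` [set x | A (- x)])) ->
  P (X @^-1` [set x | `|x| <= 1]) = 1%E -> ('E_P[X] = 0)%E.
Proof.
move=> Xsym X1; rewrite expectation_def integralE.
have mX : measurable_fun setT X by exact: measurable_funPT.
have mNX : measurable_fun setT (fun w => - X w).
  exact: measurable_funN.
pose f (x : R) : \bar R := (Num.max x 0)%:E.
have mf : measurable_fun setT f.
  apply/measurable_EFinP.
  exact: measurable_maxr.
have f0 x : (0 <= f x)%E by rewrite lee_fin le_max lexx orbT.
have pE : (\int[P]_w ((fun w => (X w)%:E) ^\+ w) = \int[P]_w f (X w))%E.
  by apply: eq_integral => w _; rewrite funeposE /f EFin_max.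
have nE : (\int[P]_w ((fun w => (X w)%:E)^\-%E w) = \int[P]_w f (- X w)%R)%E.
  by apply: eq_integral => w _; rewrite funenegE /f EFin_max.
have pnE : (\int[P]_w f (X w) = \int[P]_w f (- X w)%R)%E.
  have := ge0_integral_pushforward mX P measurableT mf (fun y _ => f0 y).
  have := ge0_integral_pushforward mNX P measurableT mf (fun y _ => f0 y).
  rewrite !preimage_setT => <- <-.
  by apply: eq_measure_integral => A mA _; exact: Xsym.
rewrite pE nE -pnE subee//.
rewrite ge0_fin_numE; last by apply: integral_ge0 => w _.
apply: (@le_lt_trans _ _ (\int[P]_w 1)%E); last first.
  rewrite integral_cst// mul1e.
  by rewrite (le_lt_trans (probability_le1 P measurableT)) ?ltry.
apply: ae_ge0_le_integral => //.
  exact: measurableT_comp.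
have mX1 : measurable (X @^-1` [set x | `|x| <= 1]).
  by apply: measurable_funPTI; exact: measurable_abs_le.
have PN : P (~` (X @^-1` [set x | `|x| <= 1])) = 0%E.
  by rewrite probability_setC// X1 subee.
exists (~` (X @^-1` [set x | `|x| <= 1])); split => //.
- exact: measurableC.
- move=> w /= H; apply: contra_not H => Xw _.
  rewrite /f lee_fin ge_max ler01 andbT.
  by apply: le_trans Xw; exact: ler_norm.
Qed.

End Laws.

(** * Singular values of matrices with small entries *)

Section SmallEntries.
Variables (R : realType) (n p : nat) (A : 'M[R]_(n, p)) (u : R).
Hypothesis u0 : 0 <= u.

Let sqr_le_small (a : R) : `|a| <= u -> a ^+ 2 <= u ^+ 2.
Proof. by move=> au; rewrite -real_normK ?num_real// lerXn2r ?nnegrE. Qed.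

Lemma smin_le_small_entries : (0 < n)%N -> (0 < p)%N ->
  (forall i j, `|A i j| <= u) -> smin A <= (n * p)%:R * u.
Proof.
move=> n0 p0 Au.
rewrite -(@ler_pXn2r _ 2)// ?nnegrE ?nth_singular_values_ge0 ?mulr_ge0//.
apply: le_trans (smin_le_frobenius A) _.
apply: (@le_trans _ _ (\sum_(i < n) \sum_(j < p) u ^+ 2)).
  by do 2 (apply: ler_sum => ? _); exact: sqr_le_small.
rewrite !sumr_const !card_ord -mulrnA mulnC -[leLHS]mulr_natl exprMn.
rewrite ler_wpM2r ?sqr_ge0// -natrX ler_nat.
by rewrite expnS expn1 leq_pmull// muln_gt0 n0.
Qed.

(** Let [a] be the square of the large entry and [e = n p u ^ 2], so that the
    squared Frobenius norm is at most [a + e].  Then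
    [a ^ 2 <= smax ^ 2 * (a + e)] forces [smax ^ 2 >= a - e], and what is left
    for [smin ^ 2] in the Frobenius norm is at most [2 e].  The same inequality,
    with [a >= 1/4] and [e <= n p], bounds [smax] from below by a constant. *)
Lemma smax_ge_smin_le_one_large_entry (i0 : 'I_n) (j0 : 'I_p) :
  (2 <= n)%N -> (2 <= p)%N -> u <= 1 -> 2^-1 <= `|A i0 j0| ->
  (forall i j, (i, j) != (i0, j0) -> `|A i j| <= u) ->
  (4 + 16 * (n * p)%:R)^-1 <= smax A /\ smin A <= (n * p)%:R * u.
Proof.
move=> n2 p2 u1 A0 Au; set N : R := (n * p)%:R.
pose a := A i0 j0 ^+ 2; pose e := N * u ^+ 2.
have N4 : 4 <= N by rewrite /N (ler_nat R 4) (leq_mul n2 p2).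
have frob : \sum_i \sum_j A i j ^+ 2 <= a + e.
  rewrite pair_big (bigD1 (i0, j0))//= lerD2l.
  apply: (@le_trans _ _ (\sum_(ij : 'I_n * 'I_p) u ^+ 2)).
    rewrite [leRHS](bigD1 (i0, j0))//= -[leLHS]add0r lerD ?sqr_ge0//.
    by apply: ler_sum => -[i j] ij; exact/sqr_le_small/Au.
  by rewrite sumr_const card_prod !card_ord -mulr_natl.
have a4 : 4^-1 <= a.
  have -> : 4^-1 = 2^-1 ^+ 2 :> R by rewrite exprVn; congr _^-1; ring.
  rewrite /a -[leRHS]real_normK ?num_real//.
  by rewrite lerXn2r ?nnegrE.
have e0 : 0 <= e by rewrite mulr_ge0 ?sqr_ge0.
have eN : e <= N by rewrite /e ler_piMr// expr_le1.
have s1 : a ^+ 2 <= smax A ^+ 2 * (a + e).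
  apply: le_trans (sqr_entry_le_smax_frobenius A i0 j0) _.
  by rewrite ler_wpM2l ?sqr_ge0.
have s12 := le_trans (smax_smin_le_frobenius A n2 p2) frob.
have smax0 : 0 <= smax A by exact: nth_singular_values_ge0.
have smin0 : 0 <= smin A by exact: nth_singular_values_ge0.
split.
  have c1 : (4 + 16 * N)^-1 <= smax A ^+ 2.
    rewrite -[leLHS]mul1r ler_pdivrMr; last by lra.
    have a0 : 0 < a by lra.
    have aN : a + e <= a * (1 + 4 * N) by nra.
    have : a ^+ 2 <= smax A ^+ 2 * (a * (1 + 4 * N)).
      by apply: le_trans s1 _; rewrite ler_wpM2l ?sqr_ge0.
    rewrite mulrCA expr2 (ler_pM2l a0); lra.
  have c2 : (4 + 16 * N)^-1 ^+ 2 <= smax A ^+ 2.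
    apply: le_trans c1; rewrite expr2 ler_piMl ?invr_ge0 ?invf_le1//; lra.
  by rewrite -(@ler_pXn2r _ 2)// nnegrE invr_ge0; lra.
have smax_ge : a - e <= smax A ^+ 2.
  have ae : 0 < a + e by lra.
  rewrite -(ler_pM2r ae); apply: le_trans s1; nra.
have Nu0 : 0 <= N * u by rewrite mulr_ge0//; lra.
rewrite -(@ler_pXn2r _ 2)//.
have : 2 * e <= (N * u) ^+ 2.
  by rewrite /e exprMn mulrA ler_wpM2r ?sqr_ge0//; nra.
lra.
Qed.

End SmallEntries.

(** * Divergence of the expectations *)

Section ExtendedDivision.
Variable R : realType.

Lemma ediv_ge0 (x y : R) : 0 <= x -> 0 <= y -> (0 <= x%:E / y%:E)%E.
Proof.
move=> x0 y0; rewrite mule_ge0 ?lee_fin// /inve; case: eqP => // _.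
by rewrite lee_fin invr_ge0.
Qed.

(** The bound survives [y = 0], where the quotient is [+oo]. *)
Lemma ediv_ge (c K x y : R) : 0 < c -> c <= x -> 0 <= y -> y <= K ->
  ((c / K)%:E <= x%:E / y%:E)%E.
Proof.
move=> c0 cx y0 yK; have x0 := lt_le_trans c0 cx.
rewrite /inve; case: eqP => [_|/eqP yn].
  by rewrite gt0_muley ?lte_fin ?leey.
have yp : 0 < y by rewrite lt_neqAle eq_sym yn.
rewrite -EFinM lee_fin ler_pM ?invr_ge0 ?(ltW c0) ?(le_trans y0)//.
by rewrite lef_pV2 ?posrE ?(lt_le_trans yp).
Qed.

End ExtendedDivision.

Section RandomMatrix.
Context (d : measure_display) (T : measurableType d) (R : realType).
Variable P : probability T R.
Variables (n p : nat) (X Z U : 'I_n -> 'I_p -> {RV P >-> R}).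
Let N : R := (n * p)%:R.
Let cell := ('I_n * 'I_p)%type.
Hypothesis hX : forall i j w, X i j w = Z i j w * U i j w.
Hypothesis hU_iid : iid (fun ij : cell => U ij.1 ij.2).
Hypothesis hU_law : forall i j, inv_log_law (U i j).
Hypothesis hZ_iid : iid (fun ij : cell => Z ij.1 ij.2).
Hypothesis hZ_law : forall i j, rademacher (Z i j).
Hypothesis hZU : independent_families (fun ij : cell => Z ij.1 ij.2)
                                      (fun ij : cell => U ij.1 ij.2).

Let Xc (ij : cell) := X ij.1 ij.2.

Lemma entries_iid : iid Xc.
Proof.
apply: (@sign_product_iid _ _ _ P _ Xc (fun ij => Z ij.1 ij.2)
  (fun ij => U ij.1 ij.2)) => //.
- by move=> ij w; exact: hX.
- exact: hU_iid.1.
- exact: hZ_iid.1.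
- exact: hU_iid.2.
Qed.

Lemma probability_entry_flip i j (A : set R) : measurable A ->
  P (X i j @^-1` A) = (flip_prob (U i j) A)%:E.
Proof.
move=> mA; apply: (@probability_flip _ _ _ P _ Xc (fun ij => Z ij.1 ij.2)
  (fun ij => U ij.1 ij.2) _ _ _ _ _ (i, j)) => //.
- by move=> ij w; exact: hX.
- exact: hU_iid.1.
- exact: hZ_iid.1.
Qed.

(** For symmetric events the sign is invisible. *)
Lemma probability_entry_sym i j (A : set R) :
  measurable A -> (forall x, A (- x) <-> A x) ->
  P (X i j @^-1` A) = P (U i j @^-1` A).
Proof.
move=> mA Asym; rewrite probability_entry_flip// flip_prob_sym// fineK//.
by rewrite fin_num_measure//; exact: measurable_funPTI.
Qed.

Lemma probability_entry_le1 i j : P (X i j @^-1` [set x | `|x| <= 1]) = 1%E.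
Proof.
rewrite probability_entry_sym; first last.
- by move=> x /=; rewrite normrN.
- exact: measurable_abs_le.
apply/eqP; rewrite eq_le probability_le1; last first.
  by apply: measurable_funPTI; exact: measurable_abs_le.
rewrite -(hU_law i j).1 le_measure ?inE//.
- exact: measurable_funPTI.
- by apply: measurable_funPTI; exact: measurable_abs_le.
- move=> w /=; rewrite in_itv/= => /andP[U0 U1].
  by rewrite gtr0_norm// ltW.
Qed.

Lemma probability_entry_le i j u : 0 < u < 1 ->
  P (X i j @^-1` [set x | `|x| <= u]) = ((1 - ln u)^-1)%:E.
Proof.
move=> u01; rewrite probability_entry_sym ?inv_log_law_le//.
  exact: measurable_abs_le.
by move=> x /=; rewrite normrN.
Qed.

Lemma probability_entry_gt_half i j :
  P (X i j @^-1` [set x | 2^-1 < `|x|]) = (1 - (1 + ln 2)^-1)%:E.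
Proof.
rewrite probability_entry_sym ?inv_log_law_gt_half//.
  exact: measurable_abs_gt.
by move=> x /=; rewrite normrN.
Qed.

Lemma entry_subgaussian i j : mean_zero_subgaussian (X i j).
Proof.
split.
  apply: symmetric_mean0; last exact: probability_entry_le1.
  move=> A mA; rewrite probability_entry_flip//.
  have -> : [set x | A (- x)] = flip true A.
    by apply/seteqP; split => x; rewrite /flip/= expr1 mulN1r.
  by rewrite probability_entry_flip ?flip_prob_flip//; exact: measurable_flip.
have mgt t : measurable (X i j @^-1` [set x | t < `|x|]).
  by apply: measurable_funPTI; exact: measurable_abs_gt.
(* For [t < 1] the bound exceeds 1, as [2 * expR (- 1 / 4) >= 3 / 2]; for
   [t >= 1] the probability is 0. *)
exists 2 => // t t0; have [t1|t1] := ltP t 1.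
  apply: (@le_trans _ _ 1%E); first exact: (probability_le1 P (mgt t)).
  rewrite lee_fin.
  have := expR_ge1Dx (- t ^+ 2 / 2 ^+ 2).
  suff : t ^+ 2 / 2 ^+ 2 <= 2^-1 by lra.
  by rewrite ler_pdivrMr//; nra.
apply: (@le_trans _ _ 0%E); last by rewrite lee_fin mulr_ge0 ?expR_ge0.
have <- : P (~` (X i j @^-1` [set x | `|x| <= 1])) = 0%E.
  rewrite probability_setC ?probability_entry_le1 ?subee//.
  by apply: measurable_funPTI; exact: measurable_abs_le.
apply: le_measure; rewrite ?inE.
- exact: mgt.
- by apply: measurableC; apply: measurable_funPTI; exact: measurable_abs_le.
- by move=> w /= tX; apply/negP; rewrite -ltNge (le_lt_trans t1).
Qed.

Let Xmx w : 'M[R]_(n, p) := \matrix_(i, j) X i j w.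

(** The event [E t] that all entries are at most [expR (1 - t)] in absolute
    value has probability [t ^- (n * p)]. *)
Lemma integral_inv_smin_infty : (0 < n)%N -> (0 < p)%N ->
  (\int[P]_w ((Num.sqrt n%:R)%:E / (smin (Xmx w))%:E))%E = +oo%E.
Proof.
move=> n0 p0.
have N0 : 0 < N by rewrite ltr0n muln_gt0 n0.
pose E t := \bigcap_ij Xc ij @^-1` [set x | `|x| <= expR (1 - t)].
apply: (@integral_infty_of_slow_decay _ _ _ P _ E
  1 (expR (-1) / N) #|{: cell}|) => //.
- move=> w; apply: ediv_ge0; first exact: sqrtr_ge0.
  exact: nth_singular_values_ge0.
- by rewrite divr_gt0 ?expR_gt0.
- move=> t t1; apply: fin_bigcap_measurable => [|ij _].
    exact: finite_finset.
  by apply: measurable_funPTI; exact: measurable_abs_le.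
- move=> t t1; rewrite mutually_independentT; last 2 first.
  + exact: entries_iid.1.
  + by move=> _; exact: measurable_abs_le.
  rewrite (eq_bigr (fun=> (t^-1)%:E)).
    by rewrite prodEFin prodr_const exprVn div1r.
  move=> [i j] _; rewrite probability_entry_le; last first.
    by rewrite expR_gt0 expR_lt1 subr_lt0.
  by rewrite expRK opprB addrC subrK.
- move=> t w t1 Ew.
  have -> : expR (-1) / N * expR t = 1 / (N * expR (1 - t)).
    rewrite mul1r invfM -expRN mulrAC -expRD mulrC; congr (_ * expR _); lra.
  apply: ediv_ge => //.
  + by rewrite -[leLHS]sqrtr1 ler_wsqrtr// ler1n.
  + exact: nth_singular_values_ge0.
  + apply: smin_le_small_entries => //.
    by move=> i j; rewrite mxE; exact: (Ew (i, j)).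
Qed.

(** Now the entry [c0] is required to exceed [1/2], which has a fixed positive
    probability, and the other [n * p - 1] entries to be at most
    [expR (1 - t)]. *)
Lemma integral_cond_number_infty : (2 <= n)%N -> (2 <= p)%N ->
  (\int[P]_w cond_number (Xmx w))%E = +oo%E.
Proof.
move=> n2 p2.
have n0 : (0 < n)%N by exact: ltnW.
have p0 : (0 < p)%N by exact: ltnW.
have N0 : 0 < N by rewrite ltr0n muln_gt0 n0.
pose c0 : cell := (Ordinal n0, Ordinal p0).
pose A t ij : set R := if ij == c0 then [set x | 2^-1 < `|x|]
                       else [set x | `|x| <= expR (1 - t)].
have mA t ij : measurable (A t ij).
  rewrite /A; case: ifP => _; first exact: measurable_abs_gt.
  exact: measurable_abs_le.
pose E t := \bigcap_ij Xc ij @^-1` A t ij.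
pose c : R := (4 + 16 * N)^-1.
have cp : 0 < c by rewrite invr_gt0; lra.
apply: (@integral_infty_of_slow_decay _ _ _ P _ E
  (1 - (1 + ln 2)^-1) (c * (expR (-1) / N)) #|{: cell}|.-1) => //.
- by move=> w; apply: ediv_ge0; exact: nth_singular_values_ge0.
- have l2 : 0 < ln (2 : R) by rewrite ln_gt0// ltr1n.
  by rewrite subr_gt0 invf_lt1; lra.
- by rewrite mulr_gt0// divr_gt0 ?expR_gt0.
- move=> t t1; apply: fin_bigcap_measurable => [|ij _].
    exact: finite_finset.
  exact: measurable_funPTI.
- move=> t t1; rewrite mutually_independentT//; last exact: entries_iid.1.
  rewrite (bigD1 c0)//= {1}/A eqxx probability_entry_gt_half.
  rewrite (eq_bigr (fun=> (t^-1)%:E)).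
    by rewrite prodEFin prodr_const exprVn -EFinM cardC1.
  move=> [i j] /negPf ij; rewrite /A ij probability_entry_le; last first.
    by rewrite expR_gt0 expR_lt1 subr_lt0.
  by rewrite expRK opprB addrC subrK.
- move=> t w t1 Ew.
  have -> : c * (expR (-1) / N) * expR t = c / (N * expR (1 - t)).
    rewrite invfM -expRN -!mulrA; congr (_ * _).
    rewrite mulrCA -expRD; congr (_ * expR _); lra.
  have [||||||smax_ge smin_le] :=
    @smax_ge_smin_le_one_large_entry _ _ _ (Xmx w) (expR (1 - t)) _ c0.1 c0.2.
  + exact: expR_ge0.
  + exact: n2.
  + exact: p2.
  + by rewrite ltW// expR_lt1 subr_lt0.
  + by rewrite mxE ltW//; have := Ew c0 Logic.I; rewrite /A eqxx.
  + move=> i j ij; rewrite mxE; have := Ew (i, j) Logic.I.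
    by rewrite /A /= (negPf ij).
  by apply: ediv_ge => //; exact: nth_singular_values_ge0.
Qed.

End RandomMatrix.

(* The condition number of a nonzero matrix with a single row is 1, so the last
   conjunct is restricted to 2 <= n. *)
Theorem proposition4p1 (d : measure_display) (T : measurableType d)
    (R : realType) (P : probability T R) (n p : nat)
    (hn : (1 <= n)%N) (hp : (2 <= p)%N)
    (X Z U : 'I_n -> 'I_p -> {RV P >-> R})
    (hX : forall i j w, X i j w = Z i j w * U i j w)
    (hU_iid : iid (fun ij : 'I_n * 'I_p => U ij.1 ij.2))
    (hU_law : forall i j, inv_log_law (U i j))
    (hZ_iid : iid (fun ij : 'I_n * 'I_p => Z ij.1 ij.2))
    (hZ_law : forall i j, rademacher (Z i j))
    (hZU : independent_families (fun ij : 'I_n * 'I_p => Z ij.1 ij.2)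
                                (fun ij : 'I_n * 'I_p => U ij.1 ij.2)) :
  [/\ iid (fun ij : 'I_n * 'I_p => X ij.1 ij.2),
      (forall i j, mean_zero_subgaussian (X i j)),
      (\int[P]_w ((Num.sqrt n%:R)%:E /
                  (smin (\matrix_(i < n, j < p) X i j w))%:E))%E = +oo%E
    & (2 <= n)%N ->
      (\int[P]_w cond_number (\matrix_(i < n, j < p) X i j w))%E = +oo%E].
Proof.
split.
- exact: entries_iid hX hU_iid hZ_iid hZ_law hZU.
- exact: entry_subgaussian hX hU_iid hU_law hZ_iid hZ_law hZU.
- exact: (integral_inv_smin_infty hX hU_iid hU_law hZ_iid hZ_law hZU
    hn (ltnW hp)).
- move=> n2.
  exact: (integral_cond_number_infty hX hU_iid hU_law hZ_iid hZ_law hZU n2 hp).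
Qed.
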